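(* Let $n\geq 5$. Among all $n$-vertex bicyclic graphs, the graph $B_1$ has minimal total-eccentricity index; that is, $\tau(B_1)\leq \tau(B)$ for every $n$-vertex bicyclic graph $B$.
   Context: All graphs are finite and simple. For a connected graph $G$, the eccentricity $e_G(v)$ of a vertex $v$ is the largest distance from $v$ to any other vertex of $G$. The total-eccentricity index of $G$ is $\tau(G)=\sum_{u\in V(G)} e_G(u)$. An $n$-vertex bicyclic graph is a connected graph with $n$ vertices and exactly $n+1$ edges. $B_1$ is the $n$-vertex bicyclic graph obtained from the star on $n$ vertices (one vertex of degree $n-1$ and $n-1$ vertices of degree $1$) by adding two edges between pendant vertices of the star, the two added edges having no vertex in common (so that $B_1$ consists of two triangles sharing a vertex, with $n-5$ pendant vertices attached to that vertex). *)

(* Defs.v *)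
From mathcomp Require Import all_boot.

Set Implicit Arguments.
Unset Strict Implicit.
Unset Printing Implicit Defensive.

Record sgraph := SGraph {
  vertex :> finType;
  adj : rel vertex;
  adj_sym : symmetric adj;
  adj_irr : irreflexive adj
}.

Definition edges (G : sgraph) : {set {set G}} :=
  [set [set x; y] | x in G, y in G & adj x y].

Definition connected (G : sgraph) : Prop := forall x y : G, connect (@adj G) x y.

Definition walk (G : sgraph) (k : nat) (x y : G) : bool :=
  [exists p : k.-tuple G, path (@adj G) x p && (last x p == y)].

(* The least k < #|G| such that walk k x y; a shortest walk has fewer than #|G|
   edges, so the result is the junk value #|G| only when y is unreachable from x. *)
Definition dist (G : sgraph) (x y : G) : nat :=
  find (fun k => walk k x y) (iota 0 #|G|).

Definition ecc (G : sgraph) (v : G) : nat := \max_(u : G | u != v) dist v u.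

Definition tau (G : sgraph) : nat := \sum_(u : G) ecc u.

Definition bicyclic (n : nat) (G : sgraph) : Prop :=
  [/\ #|G| = n, connected G & #|edges G| = n.+1].

Section B1.
Variable n : nat.

Definition star_adj : rel 'I_n :=
  fun i j => (i != j) && ((i == 0 :> nat) || (j == 0 :> nat)).

Definition joins (a b : nat) : rel 'I_n :=
  fun i j => (i == a :> nat) && (j == b :> nat)
          || (i == b :> nat) && (j == a :> nat).

Definition B1_adj : rel 'I_n :=
  fun i j => [|| star_adj i j, joins 1 2 i j | joins 3 4 i j].

Lemma joins_sym a b : symmetric (joins a b).
Proof. by move=> i j; rewrite /joins orbC andbC [X in _ || X]andbC. Qed.

Lemma B1_adj_sym : symmetric B1_adj.
Proof.
move=> i j; rewrite /B1_adj /star_adj (joins_sym 1) (joins_sym 3) eq_sym.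
by rewrite [(i == 0 :> nat) || _]orbC.
Qed.

Lemma B1_adj_irr : irreflexive B1_adj.
Proof.
by move=> [i hi]; rewrite /B1_adj /star_adj /joins eqxx /=; case: i hi => [|[|[|[|[|]]]]].
Qed.

(* Centre 0; the edges added to the star are {1, 2} and {3, 4}, so this is the
   intended graph only for n >= 5. *)
Definition B1 : sgraph := SGraph B1_adj_sym B1_adj_irr.

End B1.

Lemma B1_bicyclic (n : nat) (hn : 5 <= n) : bicyclic n (B1 n).
Proof.
case: n hn => [|[|[|[|[|m]]]]] // _; split; first by rewrite card_ord.
  have c0 (x : B1 m.+4.+1) : connect (@adj (B1 m.+4.+1)) x (ord0 : 'I_m.+4.+1).
    have [->|nx] := eqVneq x (ord0 : 'I_m.+4.+1); first exact: connect0.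
    by apply: connect1; rewrite /= /B1_adj /star_adj nx /= orbT.
  move=> x y; apply: connect_trans (c0 x) _.
  have [->|ny] := eqVneq y (ord0 : 'I_m.+4.+1); first exact: connect0.
  by apply: connect1; rewrite /= /B1_adj /star_adj eq_sym ny.
pose v k : 'I_m.+4.+1 := inord k.
have vE k : k < 5 -> v k = k :> nat.
  by move=> hk; rewrite inordK // (leq_trans hk).
pose S : {set {set 'I_m.+4.+1}} := [set [set v 0; i] | i in [set~ v 0]].
have edgesE : edges (B1 m.+4.+1) = [set v 1; v 2] |: ([set v 3; v 4] |: S).
  apply/setP => A; rewrite !inE; apply/imset2P/or3P.
    case=> x y _; rewrite inE /= => /or3P[] h ->.
    - apply: Or33; case/andP: h => nxy /orP[] /eqP h0.
      + have -> : x = v 0 by apply: val_inj; rewrite /= h0 vE.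
        apply: imset_f; rewrite !inE; apply: contraNneq nxy => ->.
        by rewrite -val_eqE /= h0 vE.
      + have -> : y = v 0 by apply: val_inj; rewrite /= h0 vE.
        rewrite setUC; apply: imset_f; rewrite !inE; apply: contraNneq nxy => ->.
        by rewrite -val_eqE /= h0 vE.
    - apply: Or31; case/orP: h => /andP[/eqP hx /eqP hy]; apply/eqP.
      + have -> : x = v 1 by apply: val_inj; rewrite /= hx vE.
        by have -> : y = v 2 by apply: val_inj; rewrite /= hy vE.
      + have -> : x = v 2 by apply: val_inj; rewrite /= hx vE.
        have -> : y = v 1 by apply: val_inj; rewrite /= hy vE.
        exact: setUC.
    - apply: Or32; case/orP: h => /andP[/eqP hx /eqP hy]; apply/eqP.
      + have -> : x = v 3 by apply: val_inj; rewrite /= hx vE.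
        by have -> : y = v 4 by apply: val_inj; rewrite /= hy vE.
      + have -> : x = v 4 by apply: val_inj; rewrite /= hx vE.
        have -> : y = v 3 by apply: val_inj; rewrite /= hy vE.
        exact: setUC.
  case=> [/eqP->|/eqP->|/imsetP[i]].
  - by exists (v 1) (v 2); rewrite // inE /= /B1_adj /joins !vE ?orbT.
  - by exists (v 3) (v 4); rewrite // inE /= /B1_adj /joins !vE ?orbT.
  - rewrite !inE => ni ->; exists (v 0) i; rewrite // inE /= /B1_adj /star_adj.
    by rewrite eq_sym ni vE.
have vN i j : i < 5 -> j < 5 -> (v i == v j) = (i == j).
  by move=> hi hj; rewrite -val_eqE /= !vE.
have inS a b : 0 < a < 5 -> 0 < b < 5 -> [set v a; v b] \notin S.
  move=> /andP[a0 a5] /andP[b0 b5]; apply/imsetP=> -[i _] /setP/(_ (v 0)).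
  by rewrite !inE eqxx !vN //; case: a a0 {a5} => //; case: b b0 {b5}.
have cS : #|S| = m.+4.
  rewrite card_in_imset ?cardsC1 ?card_ord // => i j; rewrite !inE => ni nj /setP/(_ i).
  by rewrite !inE eqxx (negPf ni) /= => /esym/eqP.
rewrite edgesE !cardsU1 cS !inE negb_or !inS // andbT.
suff -> : [set v 1; v 2] != [set v 3; v 4] by [].
by apply/eqP => /setP/(_ (v 1)); rewrite !inE eqxx !vN.
Qed.

(* Main.v *)
Require Import Defs.
From mathcomp Require Import all_boot.

(** Both sides are compared with [2n - 1].

    In [B1] the centre reaches every vertex in one step, so every other vertex
    reaches every vertex in at most two steps; hence [tau B1 <= 1 + 2 (n - 1)].

    In any graph on [n >= 2] vertices a vertex has eccentricity at least [1],
    and eccentricity at most [1] forces it to be adjacent to all the others.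
    Two such dominating vertices would already span
    [(n - 1) + (n - 2) = 2n - 3] edges ([card_edges_dominating2]), which exceeds
    [n + 1] as soon as [n >= 5].  So a bicyclic graph has at most one vertex of
    eccentricity [1], and its total eccentricity is at least [1 + 2 (n - 1)]
    ([tau_ge]). *)

Section Distance.
Variable G : sgraph.
Implicit Types x y z : G.

Lemma dist_le_walk k x y : k < #|G| -> walk k x y -> dist x y <= k.
Proof.
move=> kG wk; rewrite /dist leqNgt; apply/negP => /(before_find 0).
by rewrite nth_iota // add0n wk.
Qed.

Lemma walk1 x y : adj x y -> walk 1 x y.
Proof. by move=> xy; apply/existsP; exists [tuple y]; rewrite /= xy eqxx. Qed.

Lemma walk2 x z y : adj x z -> adj z y -> walk 2 x y.
Proof.
by move=> xz zy; apply/existsP; exists [tuple z; y]; rewrite /= xz zy eqxx.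
Qed.

Lemma dist_le1 x y : 1 < #|G| -> x != y -> (dist x y <= 1) = adj x y.
Proof.
move=> G1 nxy; apply/idP/idP => [d1|/walk1]; last exact: dist_le_walk.
have dG : dist x y < #|G| by apply: leq_ltn_trans d1 G1.
(* A value below #|G| means that the search for a walk length succeeded. *)
have : walk (dist x y) x y.
  have := dG; rewrite {1}/dist -{2}(size_iota 0 #|G|) -has_find.
  by move=> /(nth_find 0); rewrite nth_iota // add0n.
case: (dist x y) d1 => [|[|//]] _ /existsP[p].
  by rewrite (tuple0 p) /= (negPf nxy).
case/tupleP: p => z p; rewrite (tuple0 p) /= andbT => /andP[xz /eqP <-].
exact: xz.
Qed.

Lemma dist_le_ecc x y : y != x -> dist x y <= ecc x.
Proof. exact: (leq_bigmax_cond (P := fun u => u != x) y). Qed.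

Lemma ecc_gt0 x : 1 < #|G| -> 0 < ecc x.
Proof.
move=> G1; have /card_gt0P[y] : 0 < #|[set~ x]|.
  by rewrite cardsC1; case: #|G| G1 => [|[]].
rewrite !inE => nyx; apply: leq_trans (dist_le_ecc _ _ nyx).
rewrite lt0n; apply/negP => /eqP d0.
(* Distance 0 between distinct vertices would come from a walk of length 0. *)
move: d0; rewrite /dist; case: #|G| G1 => [|m] //= _.
case: ifP => // /existsP[p]; rewrite (tuple0 p) /= => /eqP xy.
by rewrite xy eqxx in nyx.
Qed.

Lemma ecc_le1_adj x y : 1 < #|G| -> ecc x <= 1 -> y != x -> adj x y.
Proof.
move=> G1 e1 nyx; rewrite -dist_le1 // 1?eq_sym //.
exact: leq_trans (dist_le_ecc _ _ nyx) e1.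
Qed.

End Distance.

Section LowerBound.
Variable G : sgraph.
Implicit Types u v x y : G.

(** Pairing with a fixed vertex is injective away from it, which is how the
    edges at a vertex are counted. *)
Lemma card_star u (A : {set G}) :
  u \notin A -> #|[set [set u; x] | x in A]| = #|A|.
Proof.
move=> uA; apply: card_in_imset => x y xA yA /setP/(_ x).
rewrite !inE eqxx orbT.
have /negPf -> : x != u by apply: contraNneq uA => <-.
by move=> /esym/eqP.
Qed.

(** The edge joining the two dominating vertices lies in both stars, so it is
    dropped from the star of the second one. *)
Lemma card_edges_dominating2 u v :
    u != v -> (forall x, x != u -> adj u x) -> (forall x, x != v -> adj v x) ->
  #|G|.-1 + #|G|.-2 <= #|edges G|.
Proof.
move=> nuv au av.
pose A := [set~ u]; pose C := ~: [set u; v].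
pose SA := [set [set u; x] | x in A]; pose SC := [set [set v; x] | x in C].
have cA : #|SA| = #|G|.-1 by rewrite card_star ?cardsC1 // !inE eqxx.
have cC : #|SC| = #|G|.-2.
  rewrite card_star; last by rewrite !inE eqxx orbT.
  by have := cardsC [set u; v]; rewrite cards2 nuv => <-.
have dAC : SA :&: SC = set0.
  apply/setP => E; rewrite !inE; apply/negP => /andP[/imsetP[x _ ->]].
  case/imsetP=> y; rewrite !inE negb_or => /andP[/negPf yu _] /setP/(_ u).
  by rewrite !inE eqxx (negPf nuv) [u == y]eq_sym yu.
rewrite -cC -cA -[_ + _]subn0 -(cards0 {set G}) -dAC -cardsU.
apply/subset_leq_card/subsetP => E; rewrite inE.
case/orP=> /imsetP[x]; rewrite !inE => xn ->; apply/imset2P.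
  by exists u x => //; rewrite !inE au.
by exists v x => //; rewrite !inE av //; case/norP: xn.
Qed.

Lemma ecc_le1_unique u v :
  5 <= #|G| -> #|edges G| <= #|G|.+1 -> ecc u <= 1 -> ecc v <= 1 -> u = v.
Proof.
move=> G5 eG eu ev; apply/eqP; apply/negP => /negP nuv.
have G1 : 1 < #|G| by apply: leq_trans G5.
have := card_edges_dominating2 _ _ nuv (fun x => ecc_le1_adj _ u x G1 eu)
          (fun x => ecc_le1_adj _ v x G1 ev).
move=> /leq_trans/(_ eG); move: G5; case: #|G| => [|[|m]] //=; rewrite !ltnS => m3.
by rewrite -[m.+2]addn2 leq_add2l leqNgt m3.
Qed.

Lemma tau_ge : 5 <= #|G| -> #|edges G| <= #|G|.+1 -> (#|G|.-1 * 2).+1 <= tau G.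
Proof.
move=> G5 eG; have G1 : 1 < #|G| by apply: leq_trans G5.
have [c ltc] : exists c : G, forall x, x != c -> 1 < ecc x.
  have [c /= ec|big] := pickP [pred x : G | ecc x <= 1].
    exists c => x nxc; rewrite ltnNge; apply: contraNN nxc => ex.
    by apply/eqP; apply: ecc_le1_unique.
  have /card_gt0P[c _] : 0 < #|G| by apply: ltnW.
  by exists c => x _; rewrite ltnNge; have /= -> := big x.
rewrite /tau (bigD1 c) //= -add1n leq_add ?ecc_gt0 //.
by rewrite -(cardC1 c) -sum_nat_const; apply: leq_sum.
Qed.

End LowerBound.

Lemma tau_B1_le n : 5 <= n -> tau (B1 n) <= (n.-1 * 2).+1.
Proof.
case: n => [|m] // m5; set G := B1 m.+1.
have cG : #|G| = m.+1 by rewrite card_ord.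
pose c : G := (ord0 : 'I_m.+1).
have adjc (x : G) : x != c -> adj c x.
  by move=> nxc; rewrite /= /B1_adj /star_adj eq_sym nxc.
have ec : ecc c <= 1.
  apply/bigmax_leqP => x nxc; apply: dist_le_walk; last exact/walk1/adjc.
  by rewrite cG; apply: leq_trans m5.
have ex (x : G) : ecc x <= 2.
  have [->|nxc] := eqVneq x c; first exact: leqW.
  have xc : adj x c by rewrite adj_sym adjc.
  apply/bigmax_leqP => y nyx; have [->|nyc] := eqVneq y c.
    apply: leqW; apply: dist_le_walk (walk1 _ _ _ xc).
    by rewrite cG; apply: leq_trans m5.
  apply: dist_le_walk (walk2 _ _ _ _ xc (adjc y nyc)).
  by rewrite cG; apply: leq_trans m5.
rewrite /tau (bigD1 c) //= -[(m * 2).+1]add1n leq_add //.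
have cC : #|predC1 c| = m by rewrite cardC1 cG.
by rewrite -[in leqRHS]cC -sum_nat_const; apply: leq_sum.
Qed.

Theorem theorem3p5 (n : nat) (hn : 5 <= n) (B : sgraph) (hB : bicyclic n B) :
  tau (B1 n) <= tau B.
Proof.
case: hB => cB _ eB; apply: leq_trans (tau_B1_le n hn) _.
by rewrite -cB; apply: tau_ge; rewrite ?eB cB.
Qed.
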